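(* Let $Z_1, Z_2, \ldots$ be i.i.d. real random variables with continuous distribution function $F_Z$. Let $h:\mathbb{R}\to\mathbb{R}$ be a monotone increasing function, set $Y_i = h(Z_i)$, and let $F_Y$ denote the distribution function of the $Y_i$. For $n \ge 1$ and $x \in \mathbb{R}$ define $$Z^{n}(x) = \max\Big[\{Z_i : Y_i \le x,\ 1\le i\le n\} \cup \{Z_i : Y_i = \min(Y_1,\ldots,Y_n),\ 1\le i\le n\}\Big].$$ Then for every $x \in \mathbb{R}$, $$\tilde F(x) := F_Z\{Z^{n}(x)\} \to F_Y(x) \quad \text{almost surely as } n\to\infty .$$
   Context: The estimator $\tilde F(x)=F_Z\{Z^n(x)\}$, which depends on $n$, is called the margin adjustment. *)

(* Defs.v *)
From HB Require Import structures.
From mathcomp Require Import all_boot all_order all_algebra finmap.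
From mathcomp Require Import all_classical all_reals all_analysis measurable_realfun.

Set Implicit Arguments.
Unset Strict Implicit.
Unset Printing Implicit Defensive.

Import Order.TTheory GRing.Theory Num.Theory.
Import numFieldNormedType.Exports.

Local Open Scope classical_set_scope.
Local Open Scope ring_scope.

Section iid.
Context d (T : measurableType d) (R : realType) (P : probability T R).

Definition mutually_independent (X : nat -> {RV P >-> R}) : Prop :=
  forall (J : {fset nat}) (A : nat -> set R),
    (forall i, measurable (A i)) ->
    P (\bigcap_(i in [set` J]) (X i @^-1` A i)) =
      (\prod_(i <- J) P (X i @^-1` A i))%E.

(* The restriction to measurable A matters: a measure of the library is a total
   function on sets, and its values on nonmeasurable sets mean nothing. *)
Definition identically_distributed (X : nat -> {RV P >-> R}) : Prop :=
  forall (i j : nat) (A : set R),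
    measurable A -> distribution P (X i) A = distribution P (X j) A.

Definition iid (X : nat -> {RV P >-> R}) : Prop :=
  mutually_independent X /\ identically_distributed X.

End iid.

Section increasing_transform.
Context d (T : measurableType d) (R : realType) (P : probability T R).

(* Increasing is strict: for a constant h and x below that constant, the margin
   adjustment is cdf (Z 0) at the sample maximum, which tends to 1 instead of 0. *)
Lemma increasing_measurable (h : R -> R) :
  {homo h : s t / s < t} -> measurable_fun setT h.
Proof.
move=> h_incr; apply: nondecreasing_measurable => // s t.
by rewrite le_eqVlt => /predU1P[->//|/h_incr/ltW].
Qed.

Definition transform_RV (h : R -> R) (h_incr : {homo h : s t / s < t})
    (X : {RV P >-> R}) : {RV P >-> R} :=
  mfun_Sub (mem_set
    (measurableT_comp (increasing_measurable h_incr) (measurable_funPT X))).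

Lemma transform_RVE (h : R -> R) (h_incr : {homo h : s t / s < t})
    (X : {RV P >-> R}) (w : T) :
  transform_RV h_incr X w = h (X w).
Proof. by []. Qed.

End increasing_transform.

Section margin_adjustment.
Context (R : realType).

(* The default value head 0 s belongs to s as soon as s is not empty, so these
   are the true maximum and minimum; they are 0 on the empty list. *)
Definition seq_max (s : seq R) : R := \big[Num.max/head 0 s]_(z <- s) z.
Definition seq_min (s : seq R) : R := \big[Num.min/head 0 s]_(z <- s) z.

Lemma seq_max_ge (s : seq R) (z : R) : z \in s -> z <= seq_max s.
Proof. by move=> zs; exact: le_bigmax_seq. Qed.

Lemma seq_min_le (s : seq R) (z : R) : z \in s -> seq_min s <= z.
Proof. by move=> zs; exact: ge_bigmin_seq. Qed.

Lemma seq_max_mem (s : seq R) : s != [::] -> seq_max s \in s.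
Proof.
case: s => // a s _; rewrite /seq_max /= big_seq.
apply: (big_ind (fun z => z \in a :: s)) => [|y z ys zs|//].
  exact: mem_head.
by case: (leP y z).
Qed.

Lemma seq_min_mem (s : seq R) : s != [::] -> seq_min s \in s.
Proof.
case: s => // a s _; rewrite /seq_min /= big_seq.
apply: (big_ind (fun z => z \in a :: s)) => [|y z ys zs|//].
  exact: mem_head.
by case: (leP y z).
Qed.

(* Sequences are indexed from 0: the first n terms z 0, ..., z n.-1 stand for
   Z_1, ..., Z_n. The value at n = 0 is meaningless. *)
Definition Zn (z y : nat -> R) (n : nat) (x : R) : R :=
  let ymin := seq_min [seq y i | i <- iota 0 n] in
  seq_max ([seq z i | i <- iota 0 n & y i <= x] ++
           [seq z i | i <- iota 0 n & y i == ymin]).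

Definition margin_adjustment d (T : measurableType d) (P : probability T R)
    (Z Y : nat -> {RV P >-> R}) (n : nat) (x : R) (w : T) : \bar R :=
  cdf (Z 0) (Zn (fun i => Z i w) (fun i => Y i w) n x).

End margin_adjustment.

(* Main.v *)
Require Import Defs.
From mathcomp Require Import all_boot all_order all_algebra finmap.
From mathcomp Require Import all_classical all_reals all_analysis.
From mathcomp Require Import lra.

(* Put S = {s | h s <= x}, a down-set, so that F_Y(x) = P(Z_0 \in S), and fix
   e > 0. If the sample meets S then Z^n(x) lies in S and F_Z(Z^n(x)) <= F_Y(x);
   otherwise strict monotonicity of h makes Z^n(x) the smallest Z_i. Hence
   F_Z(Z^n(x)) < F_Y(x) + e as soon as some Z_i has F_Z(Z_i) < e. Conversely
   F_Z(Z^n(x)) > F_Y(x) - e as soon as some Z_i in S has F_Z(Z_i) > F_Y(x) - e.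
   Since F_Z is continuous, it takes every value in (0, 1), so both kinds of Z_i
   have positive probability; by independence they almost surely occur. *)

Import Order.TTheory GRing.Theory Num.Theory.
Import numFieldNormedType.Exports.

Local Open Scope classical_set_scope.
Local Open Scope ring_scope.

Section order_statistics.
Context {R : realType} {h : R -> R} (h_incr : {homo h : s t / s < t}).

Lemma Zn_ge (z y : nat -> R) (n : nat) (x : R) {i : nat} :
  (i < n)%N -> y i <= x -> z i <= Zn z y n x.
Proof.
move=> lt_in yix; apply: seq_max_ge; rewrite mem_cat; apply/orP; left.
by apply/mapP; exists i => //; rewrite mem_filter yix mem_iota.
Qed.

(** The maximum is attained at some [z j], either with [h (z j) <= x] or with [h (z j)] minimal. In
    the second case [z i < z j] would give [h (z i) < h (z j)] by strict monotonicity, against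
    minimality. *)
Lemma Zn_le (z : nat -> R) {n : nat} (x : R) {i : nat} : (i < n)%N ->
  h (Zn z (h \o z) n x) <= x \/ Zn z (h \o z) n x <= z i.
Proof.
move=> lt_in; rewrite /Zn; set ymin := seq_min _; set s := _ ++ _.
have ymin_mem : ymin \in [seq (h \o z) j | j <- iota 0 n].
  by apply: seq_min_mem; case: n lt_in {ymin s}.
(* An index attaining [ymin] always contributes to the second list, so the default value of
   [seq_max] never appears. *)
have s_neq0 : s != [::].
  case/mapP: ymin_mem => j jn yminE.
  suff: z j \in s by apply: contraTneq => ->.
  rewrite mem_cat; apply/orP; right; apply/mapP; exists j => //.
  by rewrite mem_filter jn andbT; apply/eqP.
move: (seq_max_mem s_neq0); rewrite {2}/s mem_cat.
case/orP => /mapP[j]; rewrite mem_filter => /andP[yj jn] ->.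
  by left.
right; rewrite leNgt; apply/negP => /h_incr; apply/negP; rewrite -leNgt.
rewrite -[h (z j)]/((h \o z) j) (eqP yj); apply: seq_min_le.
by apply/mapP; exists i; rewrite ?mem_iota.
Qed.

End order_statistics.

Section iid_hits.
Context {d} {T : measurableType d} {R : realType} {P : probability T R}.
Context {X : nat -> {RV P >-> R}} (X_iid : iid X).

Lemma iid_prob_all {A : set R} (n : nat) : measurable A ->
  P (\bigcap_(i in `I_n) (X i @^-1` A)) = ((fine (P (X 0%N @^-1` A))) ^+ n)%:E.
Proof.
move=> mA; have [indep same] := X_iid.
have -> : `I_n = [set` seq_fset tt (iota 0 n)].
  have mem_s i : (i \in seq_fset tt (iota 0 n)) = (i < n)%N.
    by rewrite seq_fsetE mem_iota.
  by apply/seteqP; split=> i /=; rewrite mem_s.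
rewrite (indep _ (fun=> A))// (eq_bigr (fun=> P (X 0%N @^-1` A))); last first.
  by move=> i _; exact: (same i 0%N A mA).
rewrite -[P (X 0%N @^-1` A)]fineK ?fin_num_measure//; last exact: measurable_funPTI.
rewrite prodEFin big_const_seq count_predT iter_mulr_1; congr (_ ^+ _)%:E.
by rewrite size_seq_fset undup_id ?iota_uniq// size_iota.
Qed.

(** Missing [A] forever implies missing it in the first [n] draws, which has probability [a ^+ n]
    with [a < 1]; let [n] tend to infinity. *)
Lemma iid_ae_hit {A : set R} : measurable A -> (0 < P (X 0%N @^-1` A))%E ->
  {ae P, forall w, exists i, A (X i w)}.
Proof.
move=> mA PA_gt0.
have mXA i B : measurable B -> measurable (X i @^-1` B).
  by move=> mB; exact: measurable_funPTI.
exists (\bigcap_i (X i @^-1` (~` A))); split.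
- by apply: bigcap_measurable => // i _; apply: mXA; exact: measurableC.
- apply/eqP; rewrite eq_le measure_ge0 andbT.
  set a := fine (P (X 0%N @^-1` (~` A))).
  have a_ge0 : 0 <= a by exact: fine_ge0.
  have a_lt1 : a < 1.
    rewrite /a -preimage_setC probability_setC; last exact: mXA.
    move: PA_gt0; rewrite -[P (X 0%N @^-1` A)]fineK; last first.
      by rewrite fin_num_measure//; exact: mXA.
    by rewrite lte_fin /= => ?; rewrite ltrBlDr ltrDl.
  have : (a ^+ n)%:E @[n --> \oo] --> (0 : R)%:E.
    by apply: cvg_EFin; [exact: nearW|apply: cvg_expr; rewrite ger0_norm].
  move=> /cvge_to_ge; apply; apply: nearW => n.
  rewrite /a -iid_prob_all; last exact: measurableC.
  apply: le_measure; rewrite ?inE.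
  + by apply: bigcap_measurable => // i _; apply: mXA; exact: measurableC.
  + by apply: bigcap_measurableType => // i _; apply: mXA; exact: measurableC.
  + by move=> w Xw i _; exact: Xw.
- by move=> w /= nA i _ /= Ai; apply: nA; exists i.
Qed.

End iid_hits.

Section continuous_cdf.
Context {d} {T : measurableType d} {R : realType} {P : probability T R}.
Context {X : {RV P >-> R}} (FX_continuous : continuous (cdf X)).

Lemma cdf_fin (r : R) : cdf X r = (fine (cdf X r))%:E.
Proof. by rewrite fineK// fin_num_measure//; exact: measurable_funPTI. Qed.

(** The limits 0 and 1 at the two infinities give points with values below and above [v]; the
    intermediate value theorem does the rest. The values 0 and 1 themselves need not be attained. *)
Lemma cdf_reach {v : R} : 0 < v < 1 -> exists r, cdf X r = v%:E.
Proof.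
move=> /andP[v_gt0 v_lt1].
have F_cont : continuous (fine \o cdf X).
  move=> r; apply: fine_cvg; rewrite -cdf_fin; exact: FX_continuous.
have [a Fa] : exists a, (cdf X a < v%:E)%E.
  have /fine_cvg/cvgr_lt/(_ v v_gt0)/filter_ex[a] := cvg_cdfNy0 X.
  by exists a; rewrite cdf_fin lte_fin.
have [b Fb] : exists b, (v%:E < cdf X b)%E.
  have /fine_cvg/cvgr_gt/(_ v v_lt1)/filter_ex[b] := cvg_cdfy1 X.
  by exists b; rewrite cdf_fin lte_fin.
have ab : a <= b.
  rewrite leNgt; apply/negP => /ltW/(cdf_nondecreasing X) ba.
  by have := lt_trans (lt_le_trans Fb ba) Fa; rewrite ltxx.
have [||c _ Fc] := @IVT R (fine \o cdf X) a b v ab.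
- exact: continuous_subspaceT.
- move: Fa Fb; rewrite /= (cdf_fin a) (cdf_fin b) !lte_fin => Fa Fb.
  by rewrite ge_min le_max (ltW Fa) (ltW Fb) orbT.
by exists c; rewrite cdf_fin -Fc.
Qed.

Lemma cdf_itv {a b : R} : a <= b ->
  P (X @^-1` `]a, b]%classic) = (cdf X b - cdf X a)%E.
Proof.
move=> ab; rewrite /cdf /= /pushforward.
have -> : X @^-1` `]a, b] = (X @^-1` `]-oo, b]) `\` (X @^-1` `]-oo, a]).
  apply/seteqP; split=> w /=; rewrite !in_itv /= ?ltNge.
    by case/andP => /negP.
  by move=> [-> /negP ->].
rewrite measureD; try exact: measurable_funPTI.
- congr (_ - P _)%E; apply/setIidr => w /=; rewrite !in_itv /=.
  by move=> /le_trans; apply.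
- by rewrite -ge0_fin_numE// fin_num_measure//; exact: measurable_funPTI.
Qed.

(** Supplies the draws for the lower bound. Pick levels q < F(u) < F(t) < p, where p is the mass of
    [S]: the interval []u, t]] has mass F(t) - F(u) > 0 and F exceeds q on it. *)
Lemma downset_hit {S : set R} {q : R} : (forall s t, s <= t -> S t -> S s) ->
    measurable S -> 0 <= q -> (q%:E < P (X @^-1` S))%E ->
  exists A : set R, [/\ measurable A, (0 < P (X @^-1` A))%E &
    forall s, A s -> S s /\ (q%:E < cdf X s)%E].
Proof.
move=> S_down mS q_ge0; set p := fine (P (X @^-1` S)).
have PSE : P (X @^-1` S) = p%:E.
  by rewrite fineK// fin_num_measure//; exact: measurable_funPTI.
rewrite PSE lte_fin => q_lt_p.
have p_le1 : p <= 1.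
  by rewrite -lee_fin -PSE probability_le1//; exact: measurable_funPTI.
(* Both levels lie strictly between [q >= 0] and [p <= 1], hence in (0, 1). *)
have [|t Ft] := cdf_reach (v:=(q + p) / 2); first by lra.
have [|u Fu] := cdf_reach (v:=(q + (q + p) / 2) / 2); first by lra.
(* Otherwise the down-set [S] would lie below [t] and have mass at most (q + p) / 2 < p. *)
have St : S t.
  apply/not_notP => nSt.
  suff: (P (X @^-1` S) <= cdf X t)%E by rewrite PSE Ft lee_fin; lra.
  apply: le_measure; rewrite ?inE; try exact: measurable_funPTI.
  move=> w /= Sw; rewrite in_itv /= leNgt; apply/negP => /ltW tw.
  exact: nSt (S_down _ _ tw Sw).
have ut : u <= t.
  rewrite leNgt; apply/negP => /ltW/(cdf_nondecreasing X).
  by rewrite Ft Fu lee_fin; lra.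
exists `]u, t]%classic; split=> //.
  by rewrite cdf_itv// Ft Fu -EFinB lte_fin; lra.
move=> s /=; rewrite in_itv /= => /andP[us st]; split; first exact: S_down St.
apply: (@lt_le_trans _ _ (cdf X u)); first by rewrite Fu lte_fin; lra.
exact/cdf_nondecreasing/ltW.
Qed.

End continuous_cdf.

Theorem theorem1 (d : measure_display) (T : measurableType d) (R : realType)
    (P : probability T R) (Z : nat -> {RV P >-> R}) (h : R -> R)
    (Z_iid : iid Z)
    (FZ_continuous : continuous (cdf (Z 0%N)))
    (h_incr : {homo h : s t / s < t}) :
  let Y := fun i : nat => transform_RV h_incr (Z i) in
  forall x : R,
    {ae P, forall w, margin_adjustment Z Y n x w @[n --> \oo] --> cdf (Y 0%N) x}.
Proof.
move=> Y x.
have h_mono s t : s <= t -> h s <= h t.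
  by rewrite le_eqVlt => /predU1P[->//|/h_incr/ltW].
pose S := [set s | h s <= x].
have S_down s t : s <= t -> S t -> S s by move=> /h_mono; exact: le_trans.
have mS : measurable S.
  have := increasing_measurable h_incr measurableT (measurable_itv `]-oo, x]).
  by rewrite setTI; congr measurable; apply/seteqP; split=> s /=; rewrite in_itv.
have FYE : cdf (Y 0%N) x = P (Z 0%N @^-1` S).
  by rewrite /cdf /= /pushforward; congr (P _); apply/seteqP; split=> w /=;
    rewrite in_itv.
set p := fine (cdf (Y 0%N) x).
have FYp : cdf (Y 0%N) x = p%:E by rewrite cdf_fin.
have near_p (e : R) : 0 < e -> {ae P, forall w, \forall n \near \oo,
    ((p - e)%:E < margin_adjustment Z Y n x w < (p + e)%:E)%E}.
  move=> e_gt0.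
  have upper : {ae P, forall w, exists i, (cdf (Z 0%N) (Z i w) < (p + e)%:E)%E}.
    (* This level is below [e] and stays in (0, 1) even when [e] is large. *)
    have [|t Ft] := cdf_reach FZ_continuous (v:=Num.min e 1 / 2).
      by case: (leP e 1) => ?; lra.
    have PA : (0 < P (Z 0%N @^-1` `]-oo, t]))%E.
      by rewrite [X in (_ < X)%E]Ft lte_fin; case: (leP e 1) => ?; lra.
    move: (iid_ae_hit Z_iid (measurable_itv _) PA); apply: filterS => w [i].
    rewrite /= in_itv /= => /(cdf_nondecreasing (Z 0%N)) Zit; exists i.
    apply: (le_lt_trans Zit); rewrite Ft lte_fin.
    have : 0 <= p by rewrite fine_ge0.
    by case: (leP e 1) => ?; lra.
  (* A negative [p - e] needs no hit, since a cdf is nonnegative; [downset_hit] covers the other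
     case. *)
  have lower : {ae P, forall w, p - e < 0 \/
      exists i, S (Z i w) /\ ((p - e)%:E < cdf (Z 0%N) (Z i w))%E}.
    have [pe_lt0|pe_ge0] := ltP (p - e) 0; first by apply: nearW => w; left.
    have [|A [mA PA AS]] := downset_hit FZ_continuous S_down mS pe_ge0.
      by rewrite -FYE FYp lte_fin ltrBlDr ltrDl.
    move: (iid_ae_hit Z_iid mA PA); apply: filterS => w [i /AS Zi].
    by right; exists i.
  move: upper lower; apply: filterS2 => w [i Fi] Fj.
  have {Fj} [m Fm] : exists m, forall n, (m <= n)%N ->
      ((p - e)%:E < margin_adjustment Z Y n x w)%E.
    case: Fj => [pe_lt0|[j [Sj Fj]]].
      by exists 0%N => n _; apply: lt_le_trans (cdf_ge0 _ _); rewrite lte_fin.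
    exists j.+1 => n lt_jn; apply: lt_le_trans Fj _.
    by apply/cdf_nondecreasing/Zn_ge.
  exists (maxn m i.+1) => // n /=; rewrite geq_max => /andP[le_mn lt_in].
  rewrite Fm//=.
  (* Either Z^n(x) lies in [S], so everything below it does too and its cdf value is at most [p], or
     it is at most the small draw [Z i w]. *)
  have [Sn|le_ni] := Zn_le h_incr (fun i => Z i w) x lt_in; last first.
    by apply: le_lt_trans Fi; exact: cdf_nondecreasing.
  apply: (@le_lt_trans _ _ p%:E); last by rewrite lte_fin ltrDl.
  rewrite -FYp FYE; apply: le_measure; rewrite ?inE.
  - exact: measurable_itv.
  - exact: mS.
  - by move=> v; rewrite /= in_itv /= => /S_down; apply.
(* The null set in [near_p] depends on [e]; taking only e = 1/(k+1) leaves a countable union of null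
   sets. *)
have : {ae P, forall w, forall k : nat, \forall n \near \oo,
    ((p - k.+1%:R^-1)%:E < margin_adjustment Z Y n x w < (p + k.+1%:R^-1)%:E)%E}.
  by apply: ae_foralln => k; apply: near_p; rewrite invr_gt0.
apply: filterS => w near_w; rewrite FYp.
apply: cvg_EFin; first by apply: nearW => n; rewrite /margin_adjustment cdf_fin.
suff near_e (e : R) : 0 < e ->
    \forall n \near \oo, `|p - fine (margin_adjustment Z Y n x w)| < e.
  by apply/cvgrPdist_lt => e; exact: near_e.
move=> e_gt0; pose k := Num.truncn e^-1.
have k_lt : k.+1%:R^-1 < e.
  by rewrite invf_plt ?posrE// truncnS_gt.
near=> n.
have : ((p - k.+1%:R^-1)%:E < margin_adjustment Z Y n x w < (p + k.+1%:R^-1)%:E)%E.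
  by near: n; exact: near_w.
rewrite /= /margin_adjustment; set r := Zn _ _ _ _.
rewrite [X in (_ < X < _)%E](cdf_fin r) !lte_fin; move: (fine _) => v /andP[lo hi].
by rewrite ltr_distlC (lt_trans _ lo) ?(lt_trans hi) ?ltrD2l ?ltrN2.
Unshelve. all: by end_near.
Qed.
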